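(* Let $\mathbf A,\mathbf B$ and $\mathbf A_i$ ($i\in I$) be De Morgan monoids, and $\mathbf S$ and $\mathbf S_i$ ($i\in I$) totally ordered odd Sugihara monoids, for a set $I$. (1) If $h\colon\mathbf A\to\mathbf B$ is a homomorphism, then the map $h'$ on $(S\setminus\{e^{\mathbf S}\})\cup A$ given by $h'(x)=h(x)$ for $x\in A$ and $h'(x)=x$ otherwise is a homomorphism from $\mathbf S[\mathbf A]$ to $\mathbf S[\mathbf B]$ extending $h$. (2) If $\mathbf P$ is a subalgebra of $\mathbf S$ and $\mathbf B$ is a subalgebra of $\mathbf A$, then $\mathbf P[\mathbf B]$ is a subalgebra of $\mathbf S[\mathbf A]$. (3) For every ultrafilter $\mathcal U$ over $I$, $\prod_{i\in I}(\mathbf S_i[\mathbf A_i])/\mathcal U\cong\big(\prod_{i\in I}\mathbf S_i/\mathcal U\big)\big[\prod_{i\in I}\mathbf A_i/\mathcal U\big]$.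
   Context: An involutive residuated lattice (IRL) is an algebra $\langle A;\cdot,\wedge,\vee,\neg,e\rangle$ with $\langle A;\cdot,e\rangle$ a commutative monoid, $\langle A;\wedge,\vee\rangle$ a lattice, $\neg\neg x=x$, and $x\cdot y\leqslant z\iff\neg z\cdot y\leqslant\neg x$; $f:=\neg e$. A De Morgan monoid is an IRL with distributive lattice satisfying $x\leqslant x\cdot x$. A Sugihara monoid is a De Morgan monoid with $a\cdot a=a$ for all $a$; odd if $f=e$. Rigorous extension: for a De Morgan monoid $\mathbf A$ and a totally ordered odd Sugihara monoid $\mathbf S$ (with disjoint universes), $\mathbf S[\mathbf A]$ is the algebra with universe $(S\setminus\{e^{\mathbf S}\})\cup A$, neutral element $e^{\mathbf A}$, whose operations $\neg$ and $\star\in\{\wedge,\vee,\cdot\}$ agree with those of $\mathbf S$ on $S\setminus\{e^{\mathbf S}\}$ and with those of $\mathbf A$ on $A$, and for $s\in S\setminus\{e^{\mathbf S}\}$, $a\in A$: $a\star s=s\star a=a$ if $e^{\mathbf S}\star^{\mathbf S}s=e^{\mathbf S}$, and $a\star s=s\star a=e^{\mathbf S}\star^{\mathbf S}s$ otherwise. $\prod_i\mathbf X_i/\mathcal U$ denotes the ultraproduct. *)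

(* Defs.v *)
From HB Require Import structures.
From mathcomp Require Import all_boot.
From mathcomp Require Import generic_quotient.
From mathcomp Require Import boolp classical_sets filter.

Set Implicit Arguments.
Unset Strict Implicit.
Unset Printing Implicit Defensive.

Local Open Scope quotient_scope.
Local Open Scope classical_set_scope.

Record algebra : Type := Algebra {
  car :> Type;
  mul : car -> car -> car;
  meet : car -> car -> car;
  join : car -> car -> car;
  neg : car -> car;
  neut : car }.

Arguments mul {a} _ _.
Arguments meet {a} _ _.
Arguments join {a} _ _.
Arguments neg {a} _.
Arguments neut {a}.

Definition leA (A : algebra) (x y : A) : Prop := meet x y = x.

Record is_lattice (A : algebra) : Prop := IsLattice {
  meetA : associative (@meet A);
  meetC : commutative (@meet A);
  joinA : associative (@join A);
  joinC : commutative (@join A);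
  meetjK : forall x y : A, meet x (join x y) = x;
  joinmK : forall x y : A, join x (meet x y) = x }.

Record is_IRL (A : algebra) : Prop := IsIRL {
  mulA : associative (@mul A);
  mulC : commutative (@mul A);
  mul1x : left_id neut (@mul A);
  irl_lattice : is_lattice A;
  negK : involutive (@neg A);
  residuation : forall x y z : A, leA (mul x y) z <-> leA (mul (neg z) y) (neg x) }.

Record is_deMorgan_monoid (A : algebra) : Prop := IsDeMorganMonoid {
  dm_IRL : is_IRL A;
  dm_distributive : right_distributive (@meet A) (@join A);
  dm_square_increasing : forall x : A, leA x (mul x x) }.

Record is_Sugihara_monoid (A : algebra) : Prop := IsSugiharaMonoid {
  sug_deMorgan : is_deMorgan_monoid A;
  sug_idempotent : idempotent_op (@mul A) }.

Definition is_odd (A : algebra) : Prop := neg neut = neut :> A.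

Definition totally_ordered (A : algebra) : Prop :=
  forall x y : A, leA x y \/ leA y x.

Record deMorganMonoid : Type := DeMorganMonoid {
  dm_alg :> algebra;
  dmP : is_deMorgan_monoid dm_alg }.

Record oddSugiharaChain : Type := OddSugiharaChain {
  osc_alg :> algebra;
  osc_Sugihara : is_Sugihara_monoid osc_alg;
  osc_odd : is_odd osc_alg;
  osc_total : totally_ordered osc_alg }.

Record is_hom (A B : algebra) (h : A -> B) : Prop := IsHom {
  hom_mul : {morph h : x y / mul x y};
  hom_meet : {morph h : x y / meet x y};
  hom_join : {morph h : x y / join x y};
  hom_neg : {morph h : x / neg x};
  hom_unit : h neut = neut }.

Definition is_iso (A B : algebra) (h : A -> B) : Prop :=
  is_hom h /\ bijective h.

Definition isomorphic (A B : algebra) : Prop :=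
  exists h : A -> B, is_iso h.


Record is_subuniverse (A : algebra) (X : set A) : Prop := IsSubuniverse {
  sub_mul : forall x y, X x -> X y -> X (mul x y);
  sub_meet : forall x y, X x -> X y -> X (meet x y);
  sub_join : forall x y, X x -> X y -> X (join x y);
  sub_neg : forall x, X x -> X (neg x);
  sub_unit : X neut }.

Section Subalgebra.
Variables (A : algebra) (X : set A) (hX : is_subuniverse X).

Definition subalgebra : algebra :=
  @Algebra {x : A | X x}
    (fun x y => exist _ _ (sub_mul hX (proj2_sig x) (proj2_sig y)))
    (fun x y => exist _ _ (sub_meet hX (proj2_sig x) (proj2_sig y)))
    (fun x y => exist _ _ (sub_join hX (proj2_sig x) (proj2_sig y)))
    (fun x => exist _ _ (sub_neg hX (proj2_sig x)))
    (exist _ _ (sub_unit hX)).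

Definition sub_incl (x : subalgebra) : A := proj1_sig x.

Lemma sub_incl_inj : injective sub_incl.
Proof. by move=> [x hx] [y hy] e; apply: eq_exist. Qed.

Lemma sub_leP (x y : subalgebra) : leA x y <-> leA (sub_incl x) (sub_incl y).
Proof. by split=> [/(congr1 sub_incl)|h]; last exact: sub_incl_inj. Qed.

Lemma sub_lattice : is_lattice A -> is_lattice subalgebra.
Proof.
case=> eA eC jA jC ej je; split.
- by move=> x y z; apply: sub_incl_inj; apply: eA.
- by move=> x y; apply: sub_incl_inj; apply: eC.
- by move=> x y z; apply: sub_incl_inj; apply: jA.
- by move=> x y; apply: sub_incl_inj; apply: jC.
- by move=> x y; apply: sub_incl_inj; apply: ej.
- by move=> x y; apply: sub_incl_inj; apply: je.
Qed.

Lemma sub_IRL : is_IRL A -> is_IRL subalgebra.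
Proof.
case=> mA mC m1 lat nK res; split; last 1 first.
- by move=> x y z; rewrite !sub_leP; apply: res.
- by move=> x y z; apply: sub_incl_inj; apply: mA.
- by move=> x y; apply: sub_incl_inj; apply: mC.
- by move=> x; apply: sub_incl_inj; apply: m1.
- exact: sub_lattice.
- by move=> x; apply: sub_incl_inj; apply: nK.
Qed.

Lemma sub_deMorgan : is_deMorgan_monoid A -> is_deMorgan_monoid subalgebra.
Proof.
case=> irl di sq; split; first exact: sub_IRL.
- by move=> x y z; apply: sub_incl_inj; apply: di.
- by move=> x; rewrite sub_leP; apply: sq.
Qed.

Lemma sub_Sugihara : is_Sugihara_monoid A -> is_Sugihara_monoid subalgebra.
Proof.
case=> dm id; split; first exact: sub_deMorgan.
by move=> x; apply: sub_incl_inj; apply: id.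
Qed.

Lemma sub_odd : is_odd A -> is_odd subalgebra.
Proof. by move=> h; apply: sub_incl_inj. Qed.

Lemma sub_total : totally_ordered A -> totally_ordered subalgebra.
Proof. by move=> h x y; rewrite !sub_leP; apply: h. Qed.

End Subalgebra.

Definition subDMM (A : deMorganMonoid) (X : set A) (hX : is_subuniverse X) :
  deMorganMonoid := DeMorganMonoid (sub_deMorgan hX (dmP A)).

Definition subOSC (S : oddSugiharaChain) (X : set S) (hX : is_subuniverse X) :
  oddSugiharaChain :=
  OddSugiharaChain (sub_Sugihara hX (osc_Sugihara S))
    (@sub_odd _ _ hX (@osc_odd S)) (@sub_total _ _ hX (@osc_total S)).


Section NonUnit.
Variable S : oddSugiharaChain.
Implicit Types s t : S.

Lemma nonunit_mul s t : s <> neut -> t <> neut -> mul s t <> neut.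
Proof.
have [[[mA mC m1 _ _ _] _ _] id] := osc_Sugihara S.
move=> s1 _ st1; apply: s1.
by rewrite -(m1 s) mC -st1 mA id.
Qed.

Lemma nonunit_meet s t : s <> neut -> t <> neut -> meet s t <> neut.
Proof.
have [[[_ _ _ [_ mC _ _ _ _] _ _] _ _] _] := osc_Sugihara S.
by move=> s1 t1; case: (osc_total s t) => [->//|]; rewrite mC => ->.
Qed.

Lemma nonunit_join s t : s <> neut -> t <> neut -> join s t <> neut.
Proof.
have [[[_ _ _ [_ mC _ jC _ je] _ _] _ _] _] := osc_Sugihara S.
by move=> s1 t1; case: (osc_total s t) => h;
  [rewrite jC -h mC je|rewrite -h mC je].
Qed.

Lemma nonunit_neg s : s <> neut -> neg s <> neut.
Proof.
have [[[_ _ _ _ nK _] _ _] _] := osc_Sugihara S.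
by move=> s1 ns1; apply: s1; rewrite -(nK s) ns1; apply: osc_odd.
Qed.

End NonUnit.

Definition nonunit (S : algebra) : Type := {s : S | s <> neut}.

Definition Nonunit (S : algebra) (s : S) (s_ne : s <> neut) : nonunit S :=
  exist _ s s_ne.

(* The (automatically disjoint) union of S \ {e} and A. *)
Definition rig_car (S A : algebra) : Type := (nonunit S + car A)%type.

Section RigorousExtension.
Variables (S : oddSugiharaChain) (A : deMorganMonoid).

(* The value of a * s = s * a for a in A, s in S \ {e}. *)
Definition rig_mix (op : S -> S -> S) (a : A) (s : nonunit S) : rig_car S A :=
  match pselect (op neut (proj1_sig s) = neut) with
  | left _ => inr a
  | right ne => inl (Nonunit ne)
  end.

Definition rig_op (opS : S -> S -> S)
    (cl : forall s t, s <> neut -> t <> neut -> opS s t <> neut)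
    (opA : A -> A -> A) (x y : rig_car S A) : rig_car S A :=
  match x, y with
  | inl s, inl t => inl (Nonunit (cl _ _ (proj2_sig s) (proj2_sig t)))
  | inl s, inr a => rig_mix opS a s
  | inr a, inl s => rig_mix opS a s
  | inr a, inr b => inr (opA a b)
  end.

Definition rig_neg (x : rig_car S A) : rig_car S A :=
  match x with
  | inl s => inl (Nonunit (nonunit_neg (proj2_sig s)))
  | inr a => inr (neg a)
  end.

Definition rigext : algebra :=
  @Algebra (rig_car S A)
    (rig_op (@nonunit_mul S) mul)
    (rig_op (@nonunit_meet S) meet)
    (rig_op (@nonunit_join S) join)
    rig_neg
    (inr neut).

End RigorousExtension.

Definition rig_map (S : oddSugiharaChain) (A B : deMorganMonoid) (h : A -> B)
    (x : rigext S A) : rigext S B :=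
  match x with
  | inl s => inl s
  | inr a => inr (h a)
  end.

Arguments rig_map S {A B} h x.

(* (P \ {e}) U B as a subset of (S \ {e}) U A *)
Definition rig_set (S : oddSugiharaChain) (A : deMorganMonoid)
    (P : set S) (B : set A) : set (rigext S A) :=
  fun x => match x with
           | inl s => P (proj1_sig s)
           | inr a => B a
           end.

Section RigInclusion.
Variables (S : oddSugiharaChain) (A : deMorganMonoid) (P : set S) (B : set A).
Hypotheses (hP : is_subuniverse P) (hB : is_subuniverse B).

Lemma sub_nonunit (p : subalgebra hP) : p <> neut -> sub_incl p <> neut.
Proof. by move=> h e; apply: h; apply: sub_incl_inj. Qed.

Definition rig_incl (x : rigext (subOSC hP) (subDMM hB)) : rigext S A :=
  match x with
  | inl p => inl (Nonunit (sub_nonunit (proj2_sig p)))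
  | inr b => inr (sub_incl b)
  end.

End RigInclusion.


Section Ultraproduct.
Variables (I : Type) (U : set_system I) (hU : UltraFilter U) (X : I -> algebra).

Definition dprod : Type := {classic (forall i, X i)}.

Definition ueq (x y : dprod) : bool := `[< U [set i | x i = y i] >].

Lemma ueq_refl : reflexive ueq.
Proof. by move=> x; apply/asboolP; apply: filterS filterT. Qed.

Lemma ueq_sym : symmetric ueq.
Proof.
by move=> x y; apply/asboolP/asboolP; apply: filterS => i /=.
Qed.

Lemma ueq_trans : transitive ueq.
Proof.
move=> y x z /asboolP xy /asboolP yz; apply/asboolP.
by apply: filterS2 xy yz => i /= ->.
Qed.

Definition ueq_equiv : equiv_rel dprod := EquivRel ueq ueq_refl ueq_sym ueq_trans.

Definition uclass : Type := {eq_quot ueq_equiv}.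

Definition ucls (x : forall i, X i) : uclass := \pi_({eq_quot ueq_equiv}) (x : dprod).

Definition urepr (c : uclass) : forall i, X i :=
  repr (c : {eq_quot ueq_equiv}).

Definition ultraproduct : algebra :=
  @Algebra uclass
    (fun x y => ucls (fun i => mul (urepr x i) (urepr y i)))
    (fun x y => ucls (fun i => meet (urepr x i) (urepr y i)))
    (fun x y => ucls (fun i => join (urepr x i) (urepr y i)))
    (fun x => ucls (fun i => neg (urepr x i)))
    (ucls (fun i => neut)).

Lemma ureprK (c : uclass) : ucls (urepr c) = c.
Proof. exact: reprK. Qed.

Lemma uclsP (x y : forall i, X i) :
  ucls x = ucls y <-> U [set i | x i = y i].
Proof.
split=> [/eqmodP /asboolP //|h]; apply/eqmodP; exact/asboolP.
Qed.

Lemma uclsK (x : forall i, X i) : U [set i | urepr (ucls x) i = x i].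
Proof. by apply/uclsP; rewrite ureprK. Qed.

(* The operations do not depend on the representatives. *)
Lemma ucls_op2 (op : forall i, X i -> X i -> X i) (x y : forall i, X i) :
  ucls (fun i => op i (urepr (ucls x) i) (urepr (ucls y) i)) =
  ucls (fun i => op i (x i) (y i)).
Proof.
by apply/uclsP; apply: filterS2 (uclsK x) (uclsK y) => i /= -> ->.
Qed.

Lemma ucls_mul (x y : forall i, X i) :
  mul (ucls x : ultraproduct) (ucls y) = ucls (fun i => mul (x i) (y i)).
Proof. exact: (@ucls_op2 (fun i => mul)). Qed.

Lemma ucls_meet (x y : forall i, X i) :
  meet (ucls x : ultraproduct) (ucls y) = ucls (fun i => meet (x i) (y i)).
Proof. exact: (@ucls_op2 (fun i => meet)). Qed.

Lemma ucls_join (x y : forall i, X i) :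
  join (ucls x : ultraproduct) (ucls y) = ucls (fun i => join (x i) (y i)).
Proof. exact: (@ucls_op2 (fun i => join)). Qed.

Lemma ucls_neg (x : forall i, X i) :
  neg (ucls x : ultraproduct) = ucls (fun i => neg (x i)).
Proof. by apply/uclsP; apply: filterS (uclsK x) => i /= ->. Qed.

Lemma ucls_ind (Q : ultraproduct -> Prop) :
  (forall x : forall i, X i, Q (ucls x)) -> forall c, Q c.
Proof. by move=> h c; rewrite -(ureprK c). Qed.

Lemma ucls_le (x y : forall i, X i) :
  leA (ucls x : ultraproduct) (ucls y) <-> U [set i | leA (x i) (y i)].
Proof. by rewrite /leA ucls_meet; apply: uclsP. Qed.

Lemma ultra_eq (x y : forall i, X i) : (forall i, x i = y i) -> ucls x = ucls y.
Proof. by move=> h; apply/uclsP; apply: filterS filterT => i _; apply: h. Qed.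

Let uE := (ucls_mul, ucls_meet, ucls_join, ucls_neg).

Lemma ultra_lattice : (forall i, is_lattice (X i)) -> is_lattice ultraproduct.
Proof.
move=> h; split.
- by do 3!elim/ucls_ind=> ?; rewrite !uE; apply: ultra_eq => i;
    apply: (meetA (h i)).
- by do 2!elim/ucls_ind=> ?; rewrite !uE; apply: ultra_eq => i;
    apply: (meetC (h i)).
- by do 3!elim/ucls_ind=> ?; rewrite !uE; apply: ultra_eq => i;
    apply: (joinA (h i)).
- by do 2!elim/ucls_ind=> ?; rewrite !uE; apply: ultra_eq => i;
    apply: (joinC (h i)).
- by do 2!elim/ucls_ind=> ?; rewrite !uE; apply: ultra_eq => i;
    apply: (meetjK (h i)).
- by do 2!elim/ucls_ind=> ?; rewrite !uE; apply: ultra_eq => i;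
    apply: (joinmK (h i)).
Qed.

Lemma ultra_IRL : (forall i, is_IRL (X i)) -> is_IRL ultraproduct.
Proof.
move=> h; split.
- by do 3!elim/ucls_ind=> ?; rewrite !uE; apply: ultra_eq => i;
    apply: (mulA (h i)).
- by do 2!elim/ucls_ind=> ?; rewrite !uE; apply: ultra_eq => i;
    apply: (mulC (h i)).
- by elim/ucls_ind=> ?; rewrite [neut]/= !uE; apply: ultra_eq => i;
    apply: (mul1x (h i)).
- by apply: ultra_lattice => i; apply: irl_lattice.
- by elim/ucls_ind=> ?; rewrite !uE; apply: ultra_eq => i;
    apply: (negK (h i)).
- elim/ucls_ind=> x; elim/ucls_ind=> y; elim/ucls_ind=> z.
  rewrite !uE !ucls_le; split; apply: filterS => i.
    by case: (residuation (h i) (x i) (y i) (z i)).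
  by case: (residuation (h i) (x i) (y i) (z i)).
Qed.

Lemma ultra_deMorgan :
  (forall i, is_deMorgan_monoid (X i)) -> is_deMorgan_monoid ultraproduct.
Proof.
move=> h; split; first by apply: ultra_IRL => i; apply: dm_IRL.
- by do 3!elim/ucls_ind=> ?; rewrite !uE; apply: ultra_eq => i;
    apply: (dm_distributive (h i)).
- elim/ucls_ind=> x; rewrite uE ucls_le.
  by apply: filterS filterT => i _; apply: (dm_square_increasing (h i)).
Qed.

Lemma ultra_Sugihara :
  (forall i, is_Sugihara_monoid (X i)) -> is_Sugihara_monoid ultraproduct.
Proof.
move=> h; split; first by apply: ultra_deMorgan => i; case: (h i).
by elim/ucls_ind=> x; rewrite uE; apply: ultra_eq => i;
  apply: (sug_idempotent (h i)).
Qed.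

Lemma ultra_odd : (forall i, is_odd (X i)) -> is_odd ultraproduct.
Proof. by move=> h; rewrite /is_odd [neut]/= ucls_neg; apply: ultra_eq. Qed.

Lemma ultra_total :
  (forall i, totally_ordered (X i)) -> totally_ordered ultraproduct.
Proof.
move=> h; elim/ucls_ind=> x; elim/ucls_ind=> y; rewrite !ucls_le.
have [?|xy] := in_ultra_setVsetC [set i | leA (x i) (y i)] hU; first by left.
by right; apply: filterS xy => i /= ?; case: (h i (x i) (y i)).
Qed.

End Ultraproduct.

Definition ultraDMM (I : Type) (U : set_system I) (hU : UltraFilter U)
    (A : I -> deMorganMonoid) : deMorganMonoid :=
  DeMorganMonoid (ultra_deMorgan hU (fun i => dmP (A i))).

Definition ultraOSC (I : Type) (U : set_system I) (hU : UltraFilter U)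
    (S : I -> oddSugiharaChain) : oddSugiharaChain :=
  OddSugiharaChain
    (ultra_Sugihara hU (fun i => osc_Sugihara (S i)))
    (@ultra_odd _ _ hU _ (fun i => @osc_odd (S i)))
    (@ultra_total _ _ hU _ (fun i => @osc_total (S i))).

(* Main.v *)
Require Import Defs.
From HB Require Import structures.
From mathcomp Require Import all_boot.
From mathcomp Require Import boolp classical_sets filter.

(* [all_boot] shadows [mul], [meet] and [join]. *)
Import Defs.

Set Implicit Arguments.
Unset Strict Implicit.
Unset Printing Implicit Defensive.

(** Every element of S[A] is [glue s a] for some s in S and a in A, where
    [glue s a] is a if s = e and s otherwise.  In this presentation each binary
    operation acts as that of S on the first coordinate and by a selection
    depending only on which first coordinates equal e on the second
    ([rig_op_glue]).  A map sending [glue s a] to [glue (f s) (g a)] is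
    therefore a homomorphism as soon as f and g are and f reflects e; this
    covers (1) and (2).  For (3), the isomorphism sends the class of
    [glue (s i) (a i)] to [glue] of the classes of s and a: the selection
    commutes with passing to classes because an ultrafilter decides whether
    s i = e almost everywhere. *)

Local Open Scope classical_set_scope.

(** * Selections governed by the identity e, and idempotence of e in S *)

Definition select (S : algebra) (T : Type) (s : S) (x y : T) : T :=
  if pselect (s = neut) then x else y.

Lemma select_neut (S : algebra) (T : Type) (s : S) (x y : T) :
  s = neut -> select s x y = x.
Proof. by rewrite /select; case: pselect. Qed.

Lemma select_nonunit (S : algebra) (T : Type) (s : S) (x y : T) :
  s <> neut -> select s x y = y.
Proof. by rewrite /select; case: pselect. Qed.

Section OddSugiharaUnit.
Variable S : oddSugiharaChain.

Let irlS : is_IRL S := dm_IRL (sug_deMorgan (osc_Sugihara S)).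
Let latS : is_lattice S := irl_lattice irlS.

Lemma osc_mulC : commutative (@mul S). Proof. exact: mulC. Qed.
Lemma osc_meetC : commutative (@meet S). Proof. exact: meetC. Qed.
Lemma osc_joinC : commutative (@join S). Proof. exact: joinC. Qed.

Lemma osc_mul_neut : mul neut neut = neut :> S.
Proof. exact: mul1x. Qed.

(** Two absorptions suffice: e ∧ e = e ∧ (e ∨ (e ∧ e)) = e. *)
Lemma osc_meet_neut : meet neut neut = neut :> S.
Proof. by rewrite -{2}(joinmK latS neut neut) (meetjK latS). Qed.

Lemma osc_join_neut : join neut neut = neut :> S.
Proof. by rewrite -{2}(meetjK latS neut neut) (joinmK latS). Qed.

End OddSugiharaUnit.

(** * Coordinates on S[A] and its operations in them *)

Section Glue.
Variables (S : oddSugiharaChain) (A : deMorganMonoid).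
Implicit Types (s t : S) (a b : A) (x y : rigext S A).

Definition glue s a : rigext S A :=
  match pselect (s = neut) with
  | left _ => inr a
  | right ne => inl (Nonunit ne)
  end.

Definition spart x : S := if x is inl s then proj1_sig s else neut.

(** On S \ {e} the value is a placeholder that [glue] discards; [neut] is chosen because it lies in
    every subuniverse and is preserved by inclusions. *)
Definition apart x : A := if x is inr a then a else neut.

Lemma glue_neut s a : s = neut -> glue s a = inr a.
Proof. by rewrite /glue; case: pselect. Qed.

Lemma glue_nonunit s a (s_ne : s <> neut) : glue s a = inl (Nonunit s_ne).
Proof.
by rewrite /glue; case: pselect => // ne; congr (inl (Nonunit _));
  apply: Prop_irrelevance.
Qed.

Lemma glue_nonunit_eq s a b : s <> neut -> glue s a = glue s b.
Proof. by move=> ne; rewrite !(glue_nonunit _ ne). Qed.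

Lemma glueK x : glue (spart x) (apart x) = x.
Proof.
by case: x => [[s ne]|a]; [rewrite glue_nonunit | rewrite glue_neut].
Qed.

Lemma spart_glue s a : spart (glue s a) = s.
Proof. by rewrite /glue; case: pselect. Qed.

Lemma apart_glue s a : s = neut -> apart (glue s a) = a.
Proof. by move=> /glue_neut ->. Qed.

Section GlueOp.
Variables (opS : S -> S -> S) (opA : A -> A -> A).
Hypothesis cl : forall s t, s <> neut -> t <> neut -> opS s t <> neut.
Hypotheses (opC : commutative opS) (op1 : opS neut neut = neut).

Lemma rig_op_glue s a t b :
  rig_op cl opA (glue s a) (glue t b) =
  glue (opS s t) (select s (select t (opA a b) a) b).
Proof.
(* When exactly one of s, t is e, [rig_mix] unfolds to [glue] of [opS neut] applied to the other
   one; [opC] is what puts e on the left when t = e. *)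
have [s1|sne] := pselect (s = neut); have [t1|tne] := pselect (t = neut).
- by rewrite !select_neut // s1 t1 op1 !glue_neut.
- by rewrite select_neut // select_nonunit // s1 glue_neut // glue_nonunit.
- by rewrite select_nonunit // t1 opC glue_nonunit // glue_neut.
- rewrite (glue_nonunit _ sne) (glue_nonunit _ tne).
  by rewrite (glue_nonunit _ (cl sne tne)).
Qed.

End GlueOp.

Lemma mul_glue s a t b :
  mul (glue s a) (glue t b) =
  glue (mul s t) (select s (select t (mul a b) a) b).
Proof. exact: (rig_op_glue _ _ (@osc_mulC S) (@osc_mul_neut S)). Qed.

Lemma meet_glue s a t b :
  meet (glue s a) (glue t b) =
  glue (meet s t) (select s (select t (meet a b) a) b).
Proof. exact: (rig_op_glue _ _ (@osc_meetC S) (@osc_meet_neut S)). Qed.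

Lemma join_glue s a t b :
  join (glue s a) (glue t b) =
  glue (join s t) (select s (select t (join a b) a) b).
Proof. exact: (rig_op_glue _ _ (@osc_joinC S) (@osc_join_neut S)). Qed.

Lemma neg_glue s a : neg (glue s a) = glue (neg s) (neg a).
Proof.
have [->|ne] := pselect (s = neut).
  by rewrite !glue_neut //; apply: osc_odd.
by rewrite !(glue_nonunit _ ne) (glue_nonunit _ (nonunit_neg ne)).
Qed.

Lemma neut_glue : neut = glue neut neut.
Proof. by rewrite glue_neut. Qed.

End Glue.

Definition glueE := (mul_glue, meet_glue, join_glue, neg_glue).

(** * Homomorphisms acting coordinatewise *)

Lemma glue_hom (S S' : oddSugiharaChain) (A A' : deMorganMonoid)
    (f : S -> S') (g : A -> A') (k : rigext S A -> rigext S' A') :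
  is_hom f -> injective f -> is_hom g ->
  (forall s a, k (glue s a) = glue (f s) (g a)) -> is_hom k.
Proof.
move=> [fM fI fJ fN f1] f_inj [gM gI gJ gN g1] kE.
(* Since f is injective and fixes the identity, f s = e exactly when s = e, so both selections take
   the same branch. *)
have selE s a b : g (select s a b) = select (f s) (g a) (g b).
  have [e|ne] := pselect (s = neut).
    by rewrite !select_neut // e.
  by rewrite !select_nonunit // => fe; apply: ne; apply: f_inj; rewrite fe.
split.
- move=> x y; rewrite -(glueK x) -(glueK y).
  by rewrite !(kE, glueE) fM !selE gM.
- move=> x y; rewrite -(glueK x) -(glueK y).
  by rewrite !(kE, glueE) fI !selE gI.
- move=> x y; rewrite -(glueK x) -(glueK y).
  by rewrite !(kE, glueE) fJ !selE gJ.
- by move=> x; rewrite -(glueK x) !(kE, glueE) fN gN.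
- by rewrite neut_glue kE f1 g1 -neut_glue.
Qed.

Lemma rig_map_hom (S : oddSugiharaChain) (A B : deMorganMonoid) (h : A -> B) :
  is_hom h -> is_hom (rig_map S h).
Proof.
move=> hh; apply: (@glue_hom S S A B id h) => // s a.
by rewrite /glue; case: pselect.
Qed.

Lemma sub_incl_hom (A : algebra) (X : set A) (hX : is_subuniverse X) :
  is_hom (@sub_incl A X hX).
Proof. by []. Qed.

(** * Subalgebras of S[A] *)

Section RigSubalgebra.
Variables (S : oddSugiharaChain) (A : deMorganMonoid) (P : set S) (C : set A).
Hypotheses (hP : is_subuniverse P) (hC : is_subuniverse C).

Lemma rig_incl_glue (p : subOSC hP) (c : subDMM hC) :
  rig_incl (glue p c) = glue (sub_incl p) (sub_incl c).
Proof.
have [e|ne] := pselect (p = neut); first by rewrite !glue_neut // e.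
by rewrite !(glue_nonunit _ ne) (glue_nonunit _ (sub_nonunit ne)).
Qed.

Lemma rig_incl_hom : is_hom (@rig_incl S A P C hP hC).
Proof.
apply: (@glue_hom (subOSC hP) S (subDMM hC) A
  (@sub_incl _ _ hP) (@sub_incl _ _ hC)).
- exact: sub_incl_hom.
- exact: sub_incl_inj.
- exact: sub_incl_hom.
- exact: rig_incl_glue.
Qed.

Lemma rig_set_glue s a : P s -> C a -> rig_set P C (glue s a).
Proof. by rewrite /glue; case: pselect. Qed.

Lemma rig_set_spart x : rig_set P C x -> P (spart x).
Proof. by case: x => //= a _; apply: sub_unit. Qed.

Lemma rig_set_apart x : rig_set P C x -> C (apart x).
Proof. by case: x => //= s _; apply: sub_unit. Qed.

Definition rig_coincl (x : rigext S A) (hx : rig_set P C x) :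
    rigext (subOSC hP) (subDMM hC) :=
  @glue (subOSC hP) (subDMM hC)
    (exist _ _ (rig_set_spart hx)) (exist _ _ (rig_set_apart hx)).

Lemma rig_coinclK x (hx : rig_set P C x) : rig_incl (rig_coincl hx) = x.
Proof. by rewrite rig_incl_glue glueK. Qed.

Lemma rig_set_incl x : rig_set P C (@rig_incl S A P C hP hC x).
Proof.
by rewrite -(glueK x) rig_incl_glue; apply: rig_set_glue; apply: proj2_sig.
Qed.

(** An element is determined by its two coordinates, and on each of them [rig_incl] acts as an
    injective inclusion. *)
Lemma rig_incl_inj : injective (@rig_incl S A P C hP hC).
Proof.
move=> x y xy; rewrite -(glueK x) -(glueK y).
have sE z : spart (rig_incl z) = sub_incl (spart z) by case: z.
have aE z : apart (rig_incl z) = sub_incl (apart z) by case: z.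
by congr glue; apply: sub_incl_inj; rewrite -?sE -?aE xy.
Qed.

(** The set is the image of the homomorphism [rig_incl], with [rig_coincl] supplying preimages, and
    such an image is closed under the operations. *)
Lemma rig_set_subuniverse : is_subuniverse (rig_set P C).
Proof.
have [iM iI iJ iN i1] := rig_incl_hom.
split.
- by move=> x y hx hy; rewrite -(rig_coinclK hx) -(rig_coinclK hy) -iM;
    apply: rig_set_incl.
- by move=> x y hx hy; rewrite -(rig_coinclK hx) -(rig_coinclK hy) -iI;
    apply: rig_set_incl.
- by move=> x y hx hy; rewrite -(rig_coinclK hx) -(rig_coinclK hy) -iJ;
    apply: rig_set_incl.
- by move=> x hx; rewrite -(rig_coinclK hx) -iN; apply: rig_set_incl.
- by rewrite -i1; apply: rig_set_incl.
Qed.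

Definition rig_sub (x : rigext (subOSC hP) (subDMM hC)) :
    subalgebra rig_set_subuniverse :=
  exist _ (rig_incl x) (rig_set_incl x).

Lemma rig_sub_iso : is_iso rig_sub.
Proof.
have [iM iI iJ iN i1] := rig_incl_hom.
split; first split; try by move=> *; apply: sub_incl_inj;
  rewrite /= ?iM ?iI ?iJ ?iN.
exists (fun x => rig_coincl (proj2_sig x)) => x.
  by apply: rig_incl_inj; rewrite rig_coinclK.
by apply: sub_incl_inj; apply: rig_coinclK.
Qed.

End RigSubalgebra.

(** * Ultraproducts of rigorous extensions *)

Section RigUltraproduct.
Variables (I : Type) (U : set_system I) (hU : UltraFilter U).

Lemma ucls_neut (X : I -> algebra) (s : forall i, X i) :
  ucls hU s = neut :> ultraproduct hU X <-> U [set i | s i = neut].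
Proof. exact: uclsP. Qed.

(** An ultrafilter contains a set or its complement and, being proper, never both. *)
Lemma ucls_nonunit (X : I -> algebra) (s : forall i, X i) :
  ucls hU s <> neut :> ultraproduct hU X <-> U [set i | s i <> neut].
Proof.
rewrite ucls_neut; split=> [ne|ne e].
  by have [//|] := in_ultra_setVsetC [set i | s i = neut] hU.
have /filter_ex[i []//] : U ([set i | s i = neut] `&` [set i | s i <> neut]).
exact: filterI.
Qed.

Lemma ucls_select (X Y : I -> algebra) (s : forall i, X i)
    (a b : forall i, Y i) :
  select (ucls hU s : ultraproduct hU X) (ucls hU a) (ucls hU b) =
  ucls hU (fun i => select (s i) (a i) (b i)).
Proof.
have [e|ne] := pselect (ucls hU s = neut :> ultraproduct hU X).
  rewrite select_neut //; apply/uclsP.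
  by apply: filterS (proj1 (ucls_neut s) e) => i /= si; rewrite select_neut.
rewrite select_nonunit //; apply/uclsP.
apply: filterS (proj1 (ucls_nonunit s) ne) => i /= si.
by rewrite select_nonunit.
Qed.

Variables (S_ : I -> oddSugiharaChain) (A_ : I -> deMorganMonoid).

Let X := ultraproduct hU (fun i => rigext (S_ i) (A_ i)).
Let Y := rigext (ultraOSC hU S_) (ultraDMM hU A_).

Let uglue (s : forall i, S_ i) (a : forall i, A_ i) : Y :=
  @glue (ultraOSC hU S_) (ultraDMM hU A_) (ucls hU s) (ucls hU a).

Definition urig (c : X) : Y :=
  uglue (fun i => spart (urepr c i)) (fun i => apart (urepr c i)).

Definition urig_inv (y : Y) : X :=
  ucls hU (fun i => glue (urepr (spart y) i) (urepr (apart y) i)).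

(** This frees [urig] from the chosen representative. First coordinates always agree almost
    everywhere; second ones are recovered only where s i = e, which is almost everywhere if the
    class of s is e, and otherwise [glue] ignores them. *)
Lemma urig_ucls (s : forall i, S_ i) (a : forall i, A_ i) :
  urig (ucls hU (fun i => glue (s i) (a i))) = uglue s a.
Proof.
rewrite /urig /uglue; set x := fun i => glue _ _.
have -> : ucls hU (fun i => spart (urepr (ucls hU x) i)) = ucls hU s.
  by apply/uclsP; apply: filterS (uclsK hU x) => i /= ->; apply: spart_glue.
have [e|ne] := pselect (ucls hU s = neut :> ultraOSC hU S_); last first.
  exact: glue_nonunit_eq.
congr glue; apply/uclsP.
apply: filterS2 (uclsK hU x) (proj1 (ucls_neut s) e) => i /= -> si.
exact: apart_glue.
Qed.

Lemma uglue_ind (Q : X -> Prop) :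
  (forall s a, Q (ucls hU (fun i => glue (s i) (a i)))) -> forall c, Q c.
Proof.
move=> QE; elim/ucls_ind => x.
have -> : ucls hU x = ucls hU (fun i => glue (spart (x i)) (apart (x i))).
  by apply: ultra_eq => i; rewrite glueK.
exact: QE.
Qed.

Lemma urig_hom : is_hom urig.
Proof.
split.
- elim/uglue_ind => s a; elim/uglue_ind => t b.
  rewrite ucls_mul !urig_ucls /uglue mul_glue !ucls_mul !ucls_select.
  (* The right side is [uglue] of two families, hence [urig] of the class of their pointwise [glue];
     this leaves an identity in each factor. *)
  rewrite -[RHS]urig_ucls.
  by congr urig; apply: ultra_eq => i; apply: mul_glue.
- elim/uglue_ind => s a; elim/uglue_ind => t b.
  rewrite ucls_meet !urig_ucls /uglue meet_glue !ucls_meet !ucls_select.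
  rewrite -[RHS]urig_ucls.
  by congr urig; apply: ultra_eq => i; apply: meet_glue.
- elim/uglue_ind => s a; elim/uglue_ind => t b.
  rewrite ucls_join !urig_ucls /uglue join_glue !ucls_join !ucls_select.
  rewrite -[RHS]urig_ucls.
  by congr urig; apply: ultra_eq => i; apply: join_glue.
- elim/uglue_ind => s a.
  rewrite ucls_neg !urig_ucls /uglue neg_glue !ucls_neg -[RHS]urig_ucls.
  by congr urig; apply: ultra_eq => i; apply: neg_glue.
(* The identity of an ultraproduct is by definition the class of the constant family [neut]. *)
- rewrite neut_glue -[RHS]/(uglue (fun=> neut) (fun=> neut)) -urig_ucls.
  by congr urig; apply: ultra_eq => i; apply: neut_glue.
Qed.

Lemma urig_invK : cancel urig_inv urig.
Proof. by move=> y; rewrite urig_ucls /uglue !ureprK glueK. Qed.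

Lemma urigK : cancel urig urig_inv.
Proof.
elim/uglue_ind => s a; rewrite urig_ucls /urig_inv /uglue spart_glue.
apply/uclsP.
(* If the class of s is e, its second coordinate is the class of a; otherwise almost every s i
   differs from e and the second coordinate is immaterial. *)
have [e|ne] := pselect (ucls hU s = neut :> ultraOSC hU S_).
  rewrite apart_glue //.
  by apply: filterS2 (uclsK hU s) (uclsK hU a) => i /= -> ->.
apply: filterS2 (uclsK hU s) (proj1 (ucls_nonunit s) ne) => i /= -> si.
exact: glue_nonunit_eq.
Qed.

Lemma urig_iso : is_iso urig.
Proof.
split; first exact: urig_hom.
by exists urig_inv; [exact: urigK | exact: urig_invK].
Qed.

End RigUltraproduct.

Theorem theorem7p20 (I : Type) (A B : deMorganMonoid) (A_ : I -> deMorganMonoid)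
    (S : oddSugiharaChain) (S_ : I -> oddSugiharaChain) :
  [/\ forall h : A -> B, is_hom h ->
        is_hom (rig_map S h)
        /\ (forall a : A, rig_map S h (inr a) = inr (h a)),
      forall (P : set S) (C : set A)
             (hP : is_subuniverse P) (hC : is_subuniverse C),
        exists (hPC : is_subuniverse (rig_set P C))
               (k : rigext (subOSC hP) (subDMM hC) -> subalgebra hPC),
          is_iso k /\ (forall x, sub_incl (k x) = rig_incl x)
    & forall (U : set_system I) (hU : UltraFilter U),
        isomorphic (ultraproduct hU (fun i => rigext (S_ i) (A_ i)))
                   (rigext (ultraOSC hU S_) (ultraDMM hU A_))].
Proof.
split.
- by move=> h hh; split=> //; apply: rig_map_hom.
- move=> P C hP hC.
  exists (rig_set_subuniverse hP hC), (@rig_sub _ _ _ _ hP hC).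
  by split=> //; apply: rig_sub_iso.
- by move=> U hU; exists (@urig _ _ hU S_ A_); apply: urig_iso.
Qed.
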